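(* Let $a,c$ be real numbers with $a\neq 0,1$ and $c\neq 0,-1,-2,\ldots$, and let $\mathcal F=(F_1,F_2)$ be a pair of finite sets of positive integers (not both empty). If $u$ is a nonnegative integer and $v\in\sigma_{\mathcal F}$, then $$q_u^{\mathcal F}(v)=\kappa\,\xi_u\,\zeta_v\,m_v^{a,c;\mathcal F}(u),$$ where $$\kappa=\frac{(-1)^{\sum_{f\in F_2}f}\,a^{k_2(k_1+1)+\sum_{f\in F_2}f}\prod_{f\in F_1}f!\prod_{f\in F_2}f!}{(a-1)^{k_2(k_1+1)}\prod_{f\in F_1}(1+c)_{f-1}\prod_{f\in F_2}(1+c)_{f-1}},$$ $$\xi_u=\frac{a^{(k_1+1)u}\prod_{i=0}^k(1+c)_{u+i-1}}{(a-1)^{(k+1)u}\prod_{i=0}^k(u+i)!},$$ $$\zeta_v=\frac{(a-1)^v\,(v-u_{\mathcal F})!}{a^v\,(1+c)_{v-u_{\mathcal F}-1}\prod_{f\in F_1}(v-f-u_{\mathcal F})\prod_{f\in F_2}(v+c+f-u_{\mathcal F})}.$$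
   Context: Pochhammer symbol: $(y)_j=\Gamma(y+j)/\Gamma(y)$, i.e. $(y)_j=y(y+1)\cdots(y+j-1)$ for $j\ge 1$, $(y)_0=1$, and $(y)_{-1}=1/(y-1)$ (so $(1+c)_{-1}=1/c$). Meixner polynomials: for $a\ne 0,1$, $m_n^{a,c}(x)=\frac{a^n}{(1-a)^n}\sum_{j=0}^n a^{-j}\binom{x}{j}\binom{-x-c}{n-j}$. For a pair $\mathcal F=(F_1,F_2)$ of finite sets of positive integers, let $k_i=|F_i|$, $k=k_1+k_2$, $$u_{\mathcal F}=\sum_{f\in F_1}f+\sum_{f\in F_2}f-\binom{k_1+1}{2}-\binom{k_2}{2},\qquad \sigma_{\mathcal F}=\{u_{\mathcal F},u_{\mathcal F}+1,\ldots\}\setminus\{u_{\mathcal F}+f: f\in F_1\}.$$ For $n\in\sigma_{\mathcal F}$, $m_n^{a,c;\mathcal F}(x)$ is the determinant of the $(k+1)\times(k+1)$ matrix with columns indexed by $j=0,1,\ldots,k$ whose rows are, from top to bottom: the row $\big(m_{n-u_{\mathcal F}}^{a,c}(x+j)\big)_j$; then, for each $f\in F_1$ in increasing order, the row $\big(m_f^{a,c}(x+j)\big)_j$; then, for each $f\in F_2$ in increasing order, the row $\big(m_f^{1/a,c}(x+j)/a^j\big)_j$. For $n\ge 0$, the polynomial $q_n^{\mathcal F}$ is $$q_n^{\mathcal F}(x)=\frac{\det M_n(x)}{(-1)^{nk_2}\prod_{f\in F_1}(x-f-u_{\mathcal F})\prod_{f\in F_2}(x+c+f-u_{\mathcal F})},$$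 where $M_n(x)$ is the $(k+1)\times(k+1)$ matrix with columns indexed by $j=0,\ldots,k$ whose rows are, from top to bottom: $\big(m_{n+j}^{a,c}(x-u_{\mathcal F})\big)_j$; then $\big(m_{n+j}^{a,c}(f)\big)_j$ for $f\in F_1$ (increasing order); then $\big((-1)^j m_{n+j}^{1/a,c}(f)\big)_j$ for $f\in F_2$ (increasing order). *)

(* Defs.v *)
From HB Require Import structures.
From mathcomp Require Import all_boot all_order all_algebra.
From mathcomp Require Import finmap.
From mathcomp Require Import reals.

Set Implicit Arguments.
Unset Strict Implicit.
Unset Printing Implicit Defensive.

Import Order.TTheory GRing.Theory Num.Theory.
Local Open Scope ring_scope.

                                                                           
                                                         
Definition pochhammer (R : realType) (y : R) (j : int) : R :=
  match j with
  | Posz n => \prod_(i < n) (y + i%:R)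
  | Negz n => (\prod_(i < n.+1) (y - i.+1%:R))^-1
  end.

Definition gbinom (R : realType) (x : R) (j : nat) : R :=
  (\prod_(i < j) (x - i%:R)) / j`!%:R.

Definition meixner (R : realType) (a c : R) (n : nat) (x : R) : R :=
  a ^+ n / (1 - a) ^+ n *
  \sum_(j < n.+1) a ^- j * gbinom x j * gbinom (- x - c) (n - j).

                                                         
Definition incr_nth_elt (F : {fset nat}) (i : nat) : nat :=
  nth 0%N (sort leq F) i.

                                                                             
                                                                   
Definition uF (F1 F2 : {fset nat}) : nat :=
  (\sum_(f <- F1) f + \sum_(f <- F2) f
   - 'C(#|` F1|.+1, 2) - 'C(#|` F2|, 2))%N.

Definition sigmaF (F1 F2 : {fset nat}) : pred nat :=
  [pred n | (uF F1 F2 <= n)%N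
            && (n \notin [seq (uF F1 F2 + f)%N | f <- F1])].

                                                                             
Definition meixnerF (R : realType) (a c : R) (F1 F2 : {fset nat})
    (n : nat) (x : R) : R :=
  let k1 := #|` F1| in
  let k2 := #|` F2| in
  \det (col_mx
    (\row_(j < 1 + (k1 + k2)) meixner a c (n - uF F1 F2) (x + j%:R))
    (col_mx
      (\matrix_(i < k1, j < 1 + (k1 + k2))
         meixner a c (incr_nth_elt F1 i) (x + j%:R))
      (\matrix_(i < k2, j < 1 + (k1 + k2))
         (meixner a^-1 c (incr_nth_elt F2 i) (x + j%:R) / a ^+ j)))).

Definition qF_matrix (R : realType) (a c : R) (F1 F2 : {fset nat})
    (n : nat) (x : R) :
    'M[R]_(1 + (#|` F1| + #|` F2|)) :=
  let k1 := #|` F1| in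
  let k2 := #|` F2| in
  col_mx
    (\row_(j < 1 + (k1 + k2)) meixner a c (n + j) (x - (uF F1 F2)%:R))
    (col_mx
      (\matrix_(i < k1, j < 1 + (k1 + k2))
         meixner a c (n + j) (incr_nth_elt F1 i)%:R)
      (\matrix_(i < k2, j < 1 + (k1 + k2))
         ((-1) ^+ j * meixner a^-1 c (n + j) (incr_nth_elt F2 i)%:R))).

                                                                           
                                                                           
                                                             
Definition qF (R : realType) (a c : R) (F1 F2 : {fset nat})
    (n : nat) (x : R) : R :=
  \det (qF_matrix a c F1 F2 n x) /
  ((-1) ^+ (n * #|` F2|)
   * \prod_(f <- F1) (x - f%:R - (uF F1 F2)%:R)
   * \prod_(f <- F2) (x + c + f%:R - (uF F1 F2)%:R)).

Definition kappa (R : realType) (a c : R) (F1 F2 : {fset nat}) : R :=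
  let k1 := #|` F1| in
  let k2 := #|` F2| in
  ((-1) ^+ (\sum_(f <- F2) f)%N
   * a ^+ (k2 * k1.+1 + \sum_(f <- F2) f)%N
   * \prod_(f <- F1) f`!%:R * \prod_(f <- F2) f`!%:R)
  / ((a - 1) ^+ (k2 * k1.+1)
     * \prod_(f <- F1) pochhammer (1 + c) (f%:Z - 1)
     * \prod_(f <- F2) pochhammer (1 + c) (f%:Z - 1)).

Definition xi (R : realType) (a c : R) (F1 F2 : {fset nat}) (u : nat) : R :=
  let k1 := #|` F1| in
  let k := (#|` F1| + #|` F2|)%N in
  (a ^+ (k1.+1 * u)
   * \prod_(i < k.+1) pochhammer (1 + c) ((u + i)%:Z - 1))
  / ((a - 1) ^+ (k.+1 * u) * \prod_(i < k.+1) (u + i)`!%:R).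

Definition zeta (R : realType) (a c : R) (F1 F2 : {fset nat}) (v : nat) : R :=
  ((a - 1) ^+ v * (v - uF F1 F2)`!%:R)
  / (a ^+ v * pochhammer (1 + c) (v%:Z - (uF F1 F2)%:Z - 1)
     * \prod_(f <- F1) (v%:R - f%:R - (uF F1 F2)%:R)
     * \prod_(f <- F2) (v%:R + c + f%:R - (uF F1 F2)%:R)).

(* Main.v *)
(* At nonnegative integers the Meixner polynomials are self-dual: up to a
   weight w_n depending on one index only,
     m_n(m) / w_n = c * sum_k C(n,k) C(m,k) k! / (c)_k (1 - 1/a)^k,
   which is symmetric in n and m, so m_n(m) = w_n / w_m * m_m(n); the weights
   for 1/a and for a differ by the factor (- 1/a)^n.  Hence each entry of
   M_u(v) is the matching entry of the Casoratian m_v^{a,c;F}(u) times a row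
   factor times a column factor, and both sides are the same determinant up to
   an explicit constant. *)
Require Import Defs.
From HB Require Import structures.
From mathcomp Require Import all_boot all_order all_algebra.
From mathcomp Require Import finmap.
From mathcomp Require Import reals.
From mathcomp Require Import ring zify.

Set Implicit Arguments.
Unset Strict Implicit.
Unset Printing Implicit Defensive.

Import Order.TTheory GRing.Theory Num.Theory.
Local Open Scope ring_scope.

(** * Generalized binomials and rising factorials *)

Section GeneralizedBinomial.
Variable R : realType.
Implicit Types (x e c : R) (n k : nat).

Lemma natr_fact_neq0 n : (n`!%:R : R) != 0.
Proof. by rewrite pnatr_eq0 -lt0n fact_gt0. Qed.

Lemma gbinom0 x : gbinom x 0 = 1.
Proof. by rewrite /gbinom big_ord0 fact0 divr1. Qed.

Lemma gbinom_nat m j : gbinom (m%:R : R) j = 'C(m, j)%:R.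
Proof.
apply: (canLR (mulfK (natr_fact_neq0 j))); rewrite -natrM bin_ffact.
elim: j => [|j IHj]; first by rewrite big_ord0 ffactn0.
rewrite big_ord_recr /= IHj ffactnSr natrM.
by case: (leqP j m) => [/natrB -> //|m_lt_j]; rewrite ffact_small ?mul0r.
Qed.

Lemma gbinomS x n : gbinom (x + 1) n.+1 = gbinom x n.+1 + gbinom x n.
Proof.
have prodS : \prod_(i < n.+1) (x + 1 - i%:R)
             = (x + 1) * \prod_(i < n) (x - i%:R).
  rewrite big_ord_recl subr0; congr (_ * _); apply: eq_bigr => i _.
  by rewrite lift0 -natr1; ring.
have Sn_neq0 : (n%:R + 1 : R) != 0 by rewrite natr1 pnatr_eq0.
rewrite /gbinom prodS big_ord_recr /= factS natrM -natr1.
by field; rewrite Sn_neq0 natr_fact_neq0.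
Qed.

(** The binomial series of (1 + t)^e cut after degree [n], so that a real exponent [e] stays within
    polynomials. *)
Definition gbinom_poly e n : {poly R} := \poly_(i < n.+1) gbinom e i.

(** Each factor 1 + 'X acts by Pascal's rule, and coefficients of index at most [n] do not see the
    truncation. *)
Lemma coef_exp1X_gbinom_poly e n j i : (i <= n)%N ->
  ((1 + 'X) ^+ j * gbinom_poly e n)`_i = gbinom (e + j%:R) i.
Proof.
elim: j i => [|j IHj] i le_in.
  by rewrite expr0 mul1r coef_poly ltnS le_in addr0.
rewrite exprS -mulrA mulrDl mul1r coefD coefXM IHj //.
case: i le_in => [|i] le_in /=; first by rewrite !gbinom0 addr0.
by rewrite IHj ?(ltnW le_in) // -gbinomS -addrA natr1.
Qed.

Definition rising c n : R := \prod_(i < n) (c + i%:R).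

Lemma risingD c k n : rising c (k + n) = rising c k * rising (c + k%:R) n.
Proof.
rewrite /rising big_split_ord; congr (_ * _); apply: eq_bigr => i _ /=.
by rewrite natrD addrA.
Qed.

Lemma gbinomN c n : gbinom (- c) n = (-1) ^+ n * rising c n / n`!%:R.
Proof.
rewrite /gbinom /rising; congr (_ / _).
rewrite -[X in (-1) ^+ X](card_ord n) -prodrN; apply: eq_bigr => i _; ring.
Qed.

Lemma rising_neq0 c n : (forall i : nat, c <> - i%:R) -> rising c n != 0.
Proof.
by move=> hc; apply/prodf_neq0 => i _; rewrite addr_eq0; apply/eqP/hc.
Qed.

Lemma pochhammer_rising c n : c != 0 ->
  pochhammer (1 + c) (n%:Z - 1) = rising c n / c.
Proof.
move=> c_neq0; case: n => [|n].
  (* Here the index is -1, the [Negz] branch, with value 1 / (1 + c - 1) = 1 / c. *)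
  by rewrite /rising big_ord0 /= big_ord1 mul1r; congr (_^-1); rewrite addrAC subrr add0r.
have -> : n.+1%:Z - 1 = n by rewrite -addn1 PoszD addrK.
rewrite /= /rising big_ord_recl addr0 mulrC mulKf //.
by apply: eq_bigr => i _; rewrite lift0 -natr1; ring.
Qed.

End GeneralizedBinomial.

(** * Self-duality of the Meixner polynomials at nonnegative integers *)

Section Duality.
Variables (R : realType) (a c : R).
Hypotheses (ha0 : a != 0) (ha1 : a != 1) (hc : forall i : nat, c <> - i%:R).

Let a1_neq0 : a - 1 != 0. Proof. by rewrite subr_eq0. Qed.
Let c_neq0 : c != 0. Proof. by apply/eqP; have := @hc 0%N; rewrite mulr0n oppr0. Qed.

(* Binomial expansion of
   [(1 + t / a) ^ m = ((1 + t) + (1 / a - 1) t) ^ m]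
   in the generating function [(1 + t / a) ^ m (1 + t) ^ e]. *)
Lemma sum_binom_gbinom e m n :
  \sum_(j < n.+1) a ^- j * 'C(m, j)%:R * gbinom e (n - j)
  = \sum_(k < m.+1 | (k <= n)%N)
      'C(m, k)%:R * (a^-1 - 1) ^+ k * gbinom (e + (m - k)%:R) (n - k).
Proof.
transitivity (((1 + a^-1 *: 'X) ^+ m * gbinom_poly e n)`_n).
  rewrite coefM; apply: eq_bigr => j _.
  rewrite coef_poly ltnS leq_subr; congr (_ * _).
  rewrite exprDn coef_sum.
  under eq_bigr => i _.
    rewrite expr1n mul1r coefMn exprZn coefZ coefXn.
    over.
  case: (leqP j m) => [le_jm | lt_mj].
    rewrite (bigD1 (Ordinal (le_jm : (j < m.+1)%N))) //= eqxx mulr1.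
    rewrite big1 ?addr0 => [|i]; last first.
      by rewrite eq_sym -val_eqE /= => /negPf ->; rewrite mulr0 mul0rn.
    by rewrite -[RHS]mulr_natr exprVn.
  rewrite bin_small // mulr0n mulr0 big1 // => i _.
  suff /negPf -> : (j : nat) != i by rewrite mulr0 mul0rn.
  by rewrite neq_ltn (leq_trans (ltn_ord i)) ?orbT.
have -> : 1 + a^-1 *: 'X = (1 + 'X) + (a^-1 - 1) *: 'X :> {poly R}.
  by rewrite scalerBl scale1r -addrA [_ + (_ - _)]addrC subrK.
rewrite exprDn mulr_suml coef_sum [RHS]big_mkcond; apply: eq_bigr => k _.
rewrite [in LHS]mulrnAl coefMn exprZn -scalerAr -scalerAl coefZ.
rewrite [_ * 'X^k]mulrC -[_ * gbinom_poly _ _]mulrA coefXnM ltnNge.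
case: leqP => [le_kn|_] /=.
  by rewrite coef_exp1X_gbinom_poly ?leq_subr // -[LHS]mulr_natl mulrA.
by rewrite mulr0 mul0rn.
Qed.

(** Take e = - m - c in [sum_binom_gbinom]: then e + (m - k) = - (c + k) is free of m, and its
    binomial becomes, up to sign, (c + k)_(n-k) / (n - k)! with (c + k)_(n-k) = (c)_n / (c)_k. The
    bound [N] is left free so that two such sums can share one range. *)
Lemma meixner_hypergeometric n m N : (m < N)%N ->
  meixner a c n m%:R
  = (a / (a - 1)) ^+ n * rising c n / n`!%:R
    * \sum_(k < N) 'C(n, k)%:R * 'C(m, k)%:R * k`!%:R / rising c k
                   * (1 - a^-1) ^+ k.
Proof.
move=> lt_mN; rewrite /meixner.
under eq_bigr => j _ do rewrite gbinom_nat.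
rewrite sum_binom_gbinom -expr_div_n.
have -> : a / (1 - a) = - (a / (a - 1)) by rewrite -opprB invrN mulrN.
rewrite exprNn [(-1) ^+ n * _]mulrC -!mulrA; congr (_ * _).
rewrite mulrA !mulr_sumr (big_ord_widen_cond N (fun k => (k <= n)%N)
  (fun k => (-1) ^+ n * ('C(m, k)%:R * (a^-1 - 1) ^+ k
                         * gbinom (- m%:R - c + (m - k)%:R) (n - k)))) //.
rewrite [LHS]big_mkcond.
apply: eq_bigr => k _ /=.
case: (leqP k n) => [le_kn|lt_nk] /=; last first.
  by rewrite (bin_small lt_nk) !mul0r mulr0.
rewrite ltnS; case: (leqP k m) => [le_km|lt_mk]; last first.
  by rewrite (bin_small lt_mk) mulr0 !mul0r mulr0.
have -> : - m%:R - c + (m - k)%:R = - (c + k%:R) by rewrite natrB //; ring.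
have -> : a^-1 - 1 = -1 * (1 - a^-1) by ring.
have binE : ('C(n, k)%:R : R) = n`!%:R / (k`!%:R * (n - k)`!%:R).
  by rewrite -(bin_fact le_kn) !natrM mulfK // mulf_neq0 ?natr_fact_neq0.
have rcE : rising c n = rising c k * rising (c + k%:R) (n - k).
  by rewrite -risingD subnKC.
have signE : (-1) ^+ n = (-1) ^+ k * (-1) ^+ (n - k) :> R.
  by rewrite -exprD subnKC.
rewrite gbinomN exprMn binE rcE signE.
(* The signs come from the prefactor, (-1)^n, from (1/a - 1)^k, (-1)^k, and from [gbinomN],
   (-1)^(n-k); they cancel in pairs. *)
have sk2 : (-1) ^+ k * (-1) ^+ k = 1 :> R by rewrite -expr2 sqrr_sign.
have sd2 : (-1) ^+ (n - k) * (-1) ^+ (n - k) = 1 :> R by rewrite -expr2 sqrr_sign.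
transitivity (((-1) ^+ k * (-1) ^+ k) * ((-1) ^+ (n - k) * (-1) ^+ (n - k))
  * ('C(m, k)%:R * (1 - a^-1) ^+ k * (rising (c + k%:R) (n - k) / (n - k)`!%:R))).
  by ring.
rewrite sk2 sd2 !mul1r.
by field; rewrite !natr_fact_neq0 rising_neq0.
Qed.

(** Written with (1 + c)_(n-1) = (c)_n / c, the form in which the constants of the theorem are
    given; the factor 1 / c drops out of ratios of weights. *)
Definition meixner_weight n : R :=
  (a / (a - 1)) ^+ n * pochhammer (1 + c) (n%:Z - 1) / n`!%:R.

Lemma meixner_weight_neq0 n : meixner_weight n != 0.
Proof.
rewrite /meixner_weight pochhammer_rising //.
rewrite !mulf_neq0 ?expf_neq0 ?mulf_neq0 ?invr_eq0 ?rising_neq0 //.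
exact: natr_fact_neq0.
Qed.

Lemma meixner_duality n m :
  meixner a c n m%:R
  = meixner_weight n / meixner_weight m * meixner a c m n%:R.
Proof.
have weightE i : (a / (a - 1)) ^+ i * rising c i / i`!%:R
                 = c * meixner_weight i.
  by rewrite /meixner_weight pochhammer_rising //; field; rewrite c_neq0 natr_fact_neq0.
(* With a common range the two sums differ only by the order of the two binomials. *)
rewrite (@meixner_hypergeometric n m (maxn n m).+1) ?ltnS ?leq_maxr //.
rewrite (@meixner_hypergeometric m n (maxn n m).+1) ?ltnS ?leq_maxl //.
rewrite !weightE.
under [in RHS]eq_bigr => k _ do rewrite [_ * 'C(n, k)%:R]mulrC.
by field; rewrite meixner_weight_neq0.
Qed.

Lemma prod_meixner_weight I (r : seq I) (g : I -> nat) :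
  \prod_(i <- r) meixner_weight (g i)
  = (a / (a - 1)) ^+ (\sum_(i <- r) g i)%N
    * \prod_(i <- r) pochhammer (1 + c) ((g i)%:Z - 1)
    / \prod_(i <- r) (g i)`!%:R.
Proof. by rewrite -prodrXr -prodfV -!big_split. Qed.

End Duality.

(** The base of the power becomes 1 / (1 - a) = (- 1/a) (a / (a - 1)). *)
Lemma meixner_weightV (R : realType) (a c : R) n : a != 0 -> a != 1 ->
  meixner_weight a^-1 c n = (- a^-1) ^+ n * meixner_weight a c n.
Proof.
move=> a_neq0 a_neq1; rewrite /meixner_weight !mulrA; congr (_ * _ / _).
have a1_neq0 : a - 1 != 0 by rewrite subr_eq0.
have a1N_neq0 : 1 - a != 0 by rewrite subr_eq0 eq_sym.
rewrite -exprMn; congr (_ ^+ _); field.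
by rewrite a_neq0 a1_neq0 mulN1r.
Qed.

(** * Scaling of determinants and the arithmetic of [uF] *)

Lemma det_scale (R : comNzRingType) n (r s : 'I_n -> R) (A : 'M[R]_n) :
  \det (\matrix_(i, j) (r i * s j * A i j))
  = (\prod_i r i) * (\prod_j s j) * \det A.
Proof.
have -> : \matrix_(i, j) (r i * s j * A i j)
          = diag_mx (\row_i r i) *m A *m diag_mx (\row_j s j).
  apply/matrixP => i j; rewrite mul_diag_mx mul_mx_diag !mxE; ring.
rewrite !det_mulmx !det_diag mulrAC.
by congr (_ * _ * _); apply: eq_bigr => i _; rewrite mxE.
Qed.

Lemma prod_incr_nth_elt (R : comNzRingType) (F : {fset nat}) (g : nat -> R) :
  \prod_(i < #|` F|) g (incr_nth_elt F i) = \prod_(f <- F) g f.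
Proof.
rewrite -[RHS](perm_big _ (permEl (perm_sort leq F))) /=.
by rewrite (big_nth 0%N) size_sort big_mkord.
Qed.

Lemma leq_bin2_sum_uniq (s : seq nat) : uniq s ->
  (forall f, f \in s -> (0 < f)%N) -> ('C((size s).+1, 2) <= \sum_(f <- s) f)%N.
Proof.
move=> s_uniq s_gt0; rewrite -(perm_big _ (permEl (perm_sort leq s))) /=.
have: path ltn 0 (sort leq s).
  rewrite path_sortedE; last exact: ltn_trans.
  rewrite ltn_sorted_uniq_leq sort_uniq s_uniq (sort_sorted leq_total) !andbT.
  by apply/allP => f; rewrite mem_sort => /s_gt0.
(* Generalized for the induction: the entries of an increasing list above m are at least m + 1, m +
   2, and so on. *)
have path_sum (t : seq nat) m : path ltn m t ->
    ('C((size t).+1, 2) + m * size t <= \sum_(f <- t) f)%N.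
  elim: t m => [|x t IHt] m /=; first by rewrite big_nil muln0.
  case/andP => lt_mx /IHt le_t; have := leq_mul lt_mx (leqnn (size t).+1).
  rewrite big_cons binS bin1; lia.
by move/path_sum; rewrite size_sort mul0n addn0.
Qed.

(** Distinct positive elements make the sums large enough that the natural subtractions in [uF] do
    not truncate. This is the relation that balances the exponents of a / (a - 1). *)
Lemma bin2_uF (F1 F2 : {fset nat}) :
  (forall f : nat, f \in F1 -> (0 < f)%N) ->
  (forall f : nat, f \in F2 -> (0 < f)%N) ->
  ('C((#|` F1| + #|` F2|).+1, 2) + uF F1 F2
   = #|` F2| * #|` F1|.+1 + \sum_(f <- F1) f + \sum_(f <- F2) f)%N.
Proof.
move=> hF1 hF2; rewrite /uF.
have : ('C(#|` F1|.+1, 2) <= \sum_(f <- F1) f)%N.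
  exact: (leq_bin2_sum_uniq (fset_uniq F1) hF1).
have : ('C(#|` F2|.+1, 2) <= \sum_(f <- F2) f)%N.
  exact: (leq_bin2_sum_uniq (fset_uniq F2) hF2).
have bin2_add m n : ('C((m + n).+1, 2) = 'C(m.+1, 2) + 'C(n, 2) + n * m.+1)%N.
  elim: n => [|n IHn]; first by rewrite addn0 mul0n !addn0.
  by rewrite addnS [LHS]binS IHn [in 'C(n.+1, 2)]binS !bin1; lia.
rewrite bin2_add [X in (X <= _)%N]binS; lia.
Qed.

(** * Comparison of the determinants and of the constants *)

Lemma det_qF_matrix (R : realType) (a c : R) (F1 F2 : {fset nat}) (u v : nat) :
  a != 0 -> a != 1 -> (forall i : nat, c <> - i%:R) -> (uF F1 F2 <= v)%N ->
  \det (qF_matrix a c F1 F2 u v%:R)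
  = ((meixner_weight a c (v - uF F1 F2))^-1
     * (\prod_(f <- F1) (meixner_weight a c f)^-1
        * \prod_(f <- F2) ((- a^-1) ^+ u / meixner_weight a^-1 c f)))
    * (\prod_(j < 1 + (#|` F1| + #|` F2|)) meixner_weight a c (u + j))
    * meixnerF a c F1 F2 v u%:R.
Proof.
move=> a_neq0 a_neq1 hc le_uv.
set k1 := #|` F1|; set k2 := #|` F2|.
(* The row factors are stacked in the same blocks as the matrices, so one [split] resolves both. *)
pose r : 'cV[R]_(1 + (k1 + k2)) :=
  col_mx (\col_(i < 1) (meixner_weight a c (v - uF F1 F2))^-1)
   (col_mx (\col_(i < k1) (meixner_weight a c (incr_nth_elt F1 i))^-1)
     (\col_(i < k2)
        ((- a^-1) ^+ u / meixner_weight a^-1 c (incr_nth_elt F2 i)))).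
have -> : (meixner_weight a c (v - uF F1 F2))^-1
     * (\prod_(f <- F1) (meixner_weight a c f)^-1
        * \prod_(f <- F2) ((- a^-1) ^+ u / meixner_weight a^-1 c f))
     = \prod_i r i 0.
  rewrite big_split_ord big_ord1 col_mxEu mxE; congr (_ * _).
  rewrite -!prod_incr_nth_elt big_split_ord.
  by congr (_ * _); apply: eq_bigr => i _; rewrite col_mxEd ?col_mxEu ?col_mxEd mxE.
rewrite /meixnerF -det_scale; congr (\det _); apply/matrixP => i j.
rewrite /qF_matrix !mxE; case: (split i) => {i} i; rewrite !mxE.
  by rewrite -natrB // meixner_duality // natrD [_^-1 * _]mulrC.
case: (split i) => {i} i; rewrite !mxE.
  by rewrite meixner_duality // natrD [_^-1 * _]mulrC.
rewrite meixner_duality ?invr_neq0 // ?invr_eq1 //.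
(* The weight of index u + j for 1/a brings (- 1/a)^(u+j): the part (- 1/a)^u goes to the row
   factor, and (- 1/a)^j times the sign (-1)^j gives the 1/a^j of the Casoratian. *)
rewrite meixner_weightV // natrD exprD -exprVn.
have -> : (- a^-1) ^+ j = (-1) ^+ j * a^-1 ^+ j by rewrite -exprNn.
have signK : (-1) ^+ j * (-1) ^+ j = 1 :> R by rewrite -expr2 sqrr_sign.
by move: ((-1) ^+ j) signK => s signK; rewrite -[RHS]mul1r -[X in _ = X * _]signK; ring.
Qed.

(** Collects all powers of a, a - 1 and -1 in the final identity; s1 and s2 stand for the sums over
    [F1] and [F2], and w for [uF]. *)
Lemma exponent_balance (K : fieldType) (a : K) (k1 k2 s1 s2 w u v : nat) :
  a != 0 -> a - 1 != 0 -> (w <= v)%N ->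
  ('C((k1 + k2).+1, 2) + w = k2 * k1.+1 + s1 + s2)%N ->
  ((a / (a - 1)) ^+ (v - w))^-1 * ((a / (a - 1)) ^+ s1)^-1
  * (- a^-1) ^+ (u * k2) * ((- a^-1) ^+ s2)^-1 * ((a / (a - 1)) ^+ s2)^-1
  * (a / (a - 1)) ^+ ((k1 + k2).+1 * u + 'C((k1 + k2).+1, 2))
  * ((-1) ^+ (u * k2))^-1
  = (-1) ^+ s2 * a ^+ (k2 * k1.+1 + s2) * ((a - 1) ^+ (k2 * k1.+1))^-1
    * a ^+ (k1.+1 * u) * ((a - 1) ^+ ((k1 + k2).+1 * u))^-1
    * (a - 1) ^+ v * (a ^+ v)^-1.
Proof.
move=> a_neq0 a1_neq0 le_wv binE.
have q_neq0 : a / (a - 1) != 0 by rewrite mulf_neq0 ?invr_eq0.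
have binX : (a / (a - 1)) ^+ 'C((k1 + k2).+1, 2)
    = (a / (a - 1)) ^+ (k2 * k1.+1) * (a / (a - 1)) ^+ s1
      * (a / (a - 1)) ^+ s2 / (a / (a - 1)) ^+ w.
  by rewrite -!exprD -binE exprD mulfK ?expf_neq0.
(* The part u * k2 meets (- 1/a)^(u k2), which leaves a^((k1+1)u) as in [xi]. *)
have uX : ((k1 + k2).+1 * u = k1.+1 * u + u * k2)%N by lia.
have vX (x : K) : x ^+ v = x ^+ (v - w) * x ^+ w by rewrite -exprD subnK.
rewrite !(vX a) !(vX (a - 1)) [in LHS]exprD binX uX.
move: (k1.+1 * u)%N (k2 * k1.+1)%N (u * k2)%N => n1 n2 n3.
rewrite -[- a^-1]mulN1r !exprMn !exprD !exprVn !invfM !invrK (invr_sign _ s2).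
field.
by rewrite signr_eq0 !expf_neq0.
Qed.

Theorem lemma3p2 (R : realType) (a c : R) (F1 F2 : {fset nat})
    (ha0 : a <> 0) (ha1 : a <> 1)
    (hc : forall i : nat, c <> - i%:R)
    (hF1 : forall f : nat, f \in F1 -> (0 < f)%N)
    (hF2 : forall f : nat, f \in F2 -> (0 < f)%N)
    (hF : ~ (F1 = fset0 /\ F2 = fset0))
    (u v : nat) (hv : v \in sigmaF F1 F2) :
  qF a c F1 F2 u v%:R
  = kappa a c F1 F2 * xi a c F1 F2 u * zeta a c F1 F2 v
    * meixnerF a c F1 F2 v u%:R.
Proof.
have a_neq0 : a != 0 by apply/eqP.
have a_neq1 : a != 1 by apply/eqP.
have a1_neq0 : a - 1 != 0 by rewrite subr_eq0.
have /andP[le_uv _] := hv.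
(* The Casoratian is a common factor; an identity between constants remains. *)
rewrite /qF det_qF_matrix // mulrAC; congr (_ * _).
under [X in _ * (_ * X) * _]eq_bigr => f _ do rewrite meixner_weightV // invfM mulrA.
rewrite !big_split /= !prodfV.
have sum_const n : (\sum_(f <- F2) n = n * #|` F2|)%N.
  by rewrite big_const_seq count_predT iter_addn_0.
have sum_shift n : (\sum_(i < n) (u + i) = n * u + 'C(n, 2))%N.
  rewrite big_split sum_nat_const card_ord /=.
  by rewrite -(big_mkord xpredT id) bin2_sum.
rewrite !prod_meixner_weight !prodrXr sum_const sum_shift.
rewrite /meixner_weight /kappa /xi /zeta /= subzn // add1n.
have := exponent_balance u a_neq0 a1_neq0 le_uv (bin2_uF hF1 hF2).
rewrite !invfM !invrK.
(* Factorials, Pochhammer symbols and the linear factors in v agree as atoms, and [powersE] settles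
   the remaining powers. *)
by move=> powersE; ring: powersE.
Qed.
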